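(* Let $(\mathcal{X}, d)$ be a complete metric space, and $(\mu_n)_{n\in\mathbb{N}}$ a sequence in $\mathcal{M}_1(\mathcal{X})$. Suppose for each $\varepsilon,\delta>0$ there exists a compact set $K_\varepsilon^\delta\subset\mathcal{X}$ such that $$\liminf_{n\to\infty}\mu_n\big(B_{K_\varepsilon^\delta}(\delta)\big)\ge 1-\varepsilon.$$ Then $(\mu_n)_{n\in\mathbb{N}}$ is a precompact sequence of probability measures.
   Context: $\mathcal{M}_1(\mathcal{X})$ denotes the set of Borel probability measures on $\mathcal{X}$, equipped with the topology of weak convergence; $\mu_n\to\mu$ weakly means $\int f\,\mathrm{d}\mu_n\to\int f\,\mathrm{d}\mu$ for every bounded continuous $f:\mathcal{X}\to\mathbb{R}$. A sequence in $\mathcal{M}_1(\mathcal{X})$ is called precompact if every subsequence of it has a further subsequence converging weakly to some element of $\mathcal{M}_1(\mathcal{X})$. For $x\in\mathcal{X}$, $A\subset\mathcal{X}$ and $\delta>0$, $B_x(\delta)=\{y\in\mathcal{X} : d(x,y)<\delta\}$ and $B_A(\delta)=\bigcup_{x\in A}B_x(\delta)$. *)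

(* Defs.v *)
From HB Require Import structures.
From mathcomp Require Import all_boot all_order all_algebra.
From mathcomp Require Import all_classical all_reals all_analysis.

Set Implicit Arguments.
Unset Strict Implicit.
Unset Printing Implicit Defensive.

Import Order.TTheory GRing.Theory Num.Theory.
Import numFieldNormedType.Exports.

Local Open Scope classical_set_scope.
Local Open Scope ring_scope.

(* The library's completeType includes a point, so these spaces are nonempty;
   a space carrying a probability measure is nonempty anyway. *)
#[short(type="completeMetricType")]
HB.structure Definition CompleteMetric (R : numDomainType) :=
  {T of Complete T & Metric R T}.

Definition borelType (X : ptopologicalType) : measurableType (@open X).-sigma :=
  g_sigma_algebraType (@open X).

(* In a metricType, ball x delta is [set y | mdist x y < delta] by the
   structure field ballEmdist. *)
Definition set_ball (R : realType) (X : metricType R) (A : set X) (delta : R)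
    : set X :=
  \bigcup_(x in A) ball x delta.

(* The integral is the real-valued Rintegral; it is the fine part of a finite
   integral, as bounded continuous functions are integrable. *)
Definition weak_cvg (R : realType) (X : completeMetricType R)
    (mu : nat -> probability (borelType X) R)
    (nu : probability (borelType X) R) : Prop :=
  forall f : X -> R,
    continuous f -> [bounded f x | x in [set: X]] ->
    \int[mu n]_x f x @[n --> \oo] --> \int[nu]_x f x.

Definition precompact_seq (R : realType) (X : completeMetricType R)
    (mu : nat -> probability (borelType X) R) : Prop :=
  forall phi : nat -> nat, increasing_seq phi ->
    exists psi : nat -> nat, increasing_seq psi /\
    exists nu : probability (borelType X) R,
      weak_cvg (fun n => mu (phi (psi n))) nu.

(* Main.v *)
Require Import Defs.
From mathcomp Require Import all_boot all_order all_algebra.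
From mathcomp Require Import all_classical all_reals all_analysis.
From mathcomp Require Import measurable_realfun lra.

Set Implicit Arguments.
Unset Strict Implicit.
Unset Printing Implicit Defensive.

Import Order.TTheory GRing.Theory Num.Theory.
Import numFieldNormedType.Exports.

Local Open Scope classical_set_scope.
Local Open Scope ring_scope.

(* Asymptotic tightness provides countably many balls B_i such that, at each
   scale, finitely many of them carry almost all the mass of mu_n for large n.
   The itinerary of x records to which of B_0, ..., B_(m-1) it belongs.  Along a
   subsequence the laws of all itineraries converge, and nested subintervals of
   [0, 1[ with the limiting lengths give random itineraries J_m with the limit
   laws.  Almost surely the fibers of J_m are nonempty and of arbitrarily small
   diameter, hence shrink to a point L by completeness; the limit measure is
   the law of L.  For f bounded and continuous, the infima of f over the fibers
   of J_m increase to f(L), and their means are limits of integrals bounded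
   above by those of f; this gives one half of weak convergence, and -f the
   other. *)

(** * Extraction of a pointwise convergent subsequence *)

(** By Tychonoff the sequence has a cluster point in a product of copies of [[0, 1]]. A subsequence
    approaching it on ever more coordinates, with ever smaller error, converges coordinatewise. *)
Lemma pointwise_cvg_subseq (R : realType) (u : nat -> nat -> R) :
  (forall n i, 0 <= u n i <= 1) ->
  exists psi : nat -> nat, increasing_seq psi /\
  exists p : nat -> R, forall i, u (psi n) i @[n --> \oo] --> p i.
Proof.
move=> u01.
pose T : topologicalType := prod_topology (fun _ : nat => R : topologicalType).
pose A := [set f : T | forall i, `[0, 1]%classic (f i)].
have cA : compact A.
  by apply: (@tychonoff _ (fun=> R) (fun=> `[0, 1]%classic)) => i;
    exact: segment_compact.
have [|p [_ clp]] := cA ((u : nat -> T) @ \oo) _.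
  by exists 0%N => // n _ i /=; rewrite in_itv/=.
(* The first [k] coordinates and the tolerance 1/(k+1) define a neighborhood of [p] in the product
   topology, which a cluster point forces the sequence to visit after any [N]. *)
have next (N k : nat) :
    exists n, (N < n)%N /\ forall i, (i < k)%N -> `|p i - u n i| < k.+1%:R^-1.
  have nbp : nbhs p [set f : T |
      forall i : 'I_k, `|p i - f i| < k.+1%:R^-1].
    apply: (@filter_forall T 'I_k (fun i f => `|p i - f i| < k.+1%:R^-1)
      (nbhs p) (nbhs_filter p)) => i.
    have pi : nbhs (proj i p) (ball (p i) k.+1%:R^-1).
      by apply: (@nbhsx_ballx _ R (p i : R)); rewrite invr_gt0.
    exact: (@proj_continuous nat (fun=> R) i p _ pi).
  have [|_ [[n /= Nn <-] nk]] :=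
    clp ((u : nat -> T) @` [set n | N < n]%N) _ _ nbp.
    by exists N.+1 => // n /= Nn; exists n.
  by exists n; split => // i ik; exact: (nk (Ordinal ik)).
have [nxt nxtP] := choice (fun Nk : nat * nat => next Nk.1 Nk.2).
pose psi := fix psi n := if n is m.+1 then nxt (psi m, n) else nxt (0, 0)%N.
exists psi; split.
  by apply/increasing_seqP => n; have [] := nxtP (psi n, n.+1).
exists p => i; apply/cvgrPdist_lt => e e0.
near=> n.
have [m nm] : exists m, n = m.+1.
  by exists n.-1; rewrite prednK//; near: n; exists 1%N.
have in_ : (i < n)%N by near: n; exists i.+1.
have en : n.+1%:R^-1 < e by near: n; exact: near_infty_natSinv_lt (PosNum e0).
apply: lt_trans en; rewrite nm in in_ *.
by have [_] := nxtP (psi m, m.+1); exact.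
Unshelve. all: by end_near. Qed.

(** * Realizing consistent dyadic laws on the unit interval *)

Lemma measurable_fun_to_nat d (T : measurableType d) (f : T -> nat) :
  (forall c, measurable (f @^-1` [set c])) -> measurable_fun setT f.
Proof.
move=> mf _ Y _; rewrite setTI.
rewrite (_ : f @^-1` Y = \bigcup_(c in Y) f @^-1` [set c]).
  by apply: bigcup_measurable => c _; exact: mf.
by apply/seteqP; split=> [x Yfx|x [c Yc /= ->]//]; exists (f x).
Qed.

Lemma uniform01_itv (R : realType) (a b : R) : 0 <= a -> a <= b -> b <= 1 ->
  uniform_prob (@ltr01 R) `[a, b[%classic = (b - a)%:E.
Proof.
move=> a0 ab b1; rewrite /uniform_prob integral_uniform_pdf.
rewrite setIidl; last first.
  move=> x /=; rewrite !in_itv/= => /andP[ax xb].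
  by rewrite (le_trans a0 ax) (le_trans (ltW xb) b1).
rewrite (eq_integral (fun=> 1%E)); last first.
  move=> x; rewrite inE/= in_itv/= /uniform_pdf => /andP[ax xb].
  by rewrite (le_trans a0 ax) (le_trans (ltW xb) b1)/= subr0 invr1.
rewrite integral_cst//= mul1e.
rewrite lebesgue_measure_itv/= lte_fin.
have [_|ba] := ltP a b; first by rewrite EFinB.
by rewrite (@le_anti _ _ a b) ?ab// subrr.
Qed.

(** The partial sums of [p m] cut [0, 1[ into consecutive intervals of lengths [p m c], and [J m w]
    is the index of the interval containing [w]. The splitting hypothesis makes level m+1 refine
    level m, each interval being divided into its two children. *)
Lemma dyadic_coupling (R : realType) (p : nat -> nat -> R) :
  p 0%N 0%N = 1 -> (forall m c, 0 <= p m c) ->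
  (forall m c, p m c = p m.+1 c.*2 + p m.+1 c.*2.+1) ->
  (forall m c, (2 ^ m <= c)%N -> p m c = 0) ->
  exists J : nat -> measurableTypeR R -> nat,
    [/\ forall m, measurable_fun setT (J m),
        forall m w, J m w = (J m.+1 w)./2,
        forall m w, (J m w < 2 ^ m)%N
      & forall m c, uniform_prob (@ltr01 R) (J m @^-1` [set c]) = (p m c)%:E].
Proof.
move=> p00 p_ge0 p_split p_out.
pose F m j : R := \sum_(i < j) p m i.
have F0 m : F m 0%N = 0 by rewrite /F big_ord0.
have FS m j : F m j.+1 = F m j + p m j by rewrite /F big_ord_recr.
(* Every second endpoint of level m+1 is an endpoint of level m; the nesting of the intervals rests
   on this. *)
have F_double m j : F m.+1 j.*2 = F m j.
  elim: j => [|j IH]; first by rewrite !F0.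
  by rewrite doubleS !FS IH -addrA -p_split.
have F1 m : F m (2 ^ m)%N = 1.
  elim: m => [|m IH]; first by rewrite expn0 FS F0 add0r.
  by rewrite expnS mul2n F_double.
have F_homo m : {homo F m : i j / (i <= j)%N >-> i <= j}.
  by apply: homo_leq => // [j|j]; [exact: le_trans|rewrite FS lerDl].
have F_ge0 m j : 0 <= F m j by rewrite -(F0 m); exact: (F_homo m).
pose I m c := `[F m c, F m c.+1[%classic.
have I_uniq m c c' w : I m c w -> I m c' w -> c = c'.
  rewrite /I /= !in_itv/= => /andP[cw wc] /andP[c'w wc'].
  apply/eqP; rewrite eqn_leq; apply/andP; split; rewrite leqNgt; apply/negP.
    by move=> /(F_homo m) /(lt_le_trans wc') /lt_le_trans/(_ cw); rewrite ltxx.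
  by move=> /(F_homo m) /(lt_le_trans wc) /lt_le_trans/(_ c'w); rewrite ltxx.
have I_ex m w : `[0, 1[%classic w -> exists c, (c < 2 ^ m)%N /\ I m c w.
  rewrite /= in_itv/= => /andP[w0 w1].
  have ex : exists j, w < F m j.+1.
    by exists (2 ^ m).-1; rewrite prednK ?expn_gt0// F1.
  have [c wc cmin] := ex_minnP ex; exists c; split.
    rewrite -(prednK (_ : 0 < 2 ^ m)%N) ?expn_gt0// ltnS; apply: cmin.
    by rewrite prednK ?expn_gt0// F1.
  rewrite /I /= in_itv/= wc andbT.
  case: c wc cmin => [|c] wc cmin; first by rewrite F0.
  by rewrite leNgt; apply/negP => /cmin; rewrite ltnn.
have I_parent m c w : I m.+1 c w -> I m c./2 w.
  rewrite /I /= !in_itv/= => /andP[cw wc]; apply/andP; split.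
    apply: le_trans cw; rewrite -(F_double m); apply: F_homo.
    by rewrite -{2}(odd_double_half c) leq_addl.
  apply: (lt_le_trans wc); rewrite -(F_double m); apply: F_homo.
  by rewrite doubleS ltnS -{1}(odd_double_half c); case: odd.
(* Outside [0, 1[ the index defaults to 0, which is compatible with halving and with the bound
   2^m. *)
have Jex (mw : nat * R) : exists c, (c < 2 ^ mw.1)%N /\
    if mw.2 \in `[0, 1[ then I mw.1 c mw.2 else c = 0%N.
  case: mw => m w /=; case: (boolP (w \in `[0, 1[)) => [w01|_].
    exact: I_ex.
  by exists 0%N; rewrite expn_gt0.
have {Jex} [J0 J0P] := choice Jex.
pose J m w := J0 (m, w).
have JI m w : w \in `[0, 1[ -> I m (J m w) w.
  by move=> w01; have [_] := J0P (m, w); rewrite /= w01.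
have J_out m w : w \notin `[0, 1[ -> J m w = 0%N.
  by move=> /negbTE w01; have [_] := J0P (m, w); rewrite /= w01.
have Isub m c w : (c < 2 ^ m)%N -> I m c w -> w \in `[0, 1[.
  move=> cm; rewrite /I /= !in_itv/= => /andP[cw wc].
  rewrite (le_trans (F_ge0 m c) cw)/= -(F1 m).
  exact: (lt_le_trans wc (F_homo m _ _ cm)).
have J_lt m w : (J m w < 2 ^ m)%N by have [] := J0P (m, w).
have pJ m c : (c < 2 ^ m)%N -> J m @^-1` [set c] =
    I m c `|` (~` `[0, 1[%classic `&` [set w | c = 0%N]).
  move=> cm; apply/seteqP; split => [w /= <-|w].
    have [w01|w01] := boolP (w \in `[0, 1[); first by left; exact: JI.
    by right; rewrite J_out//; split => //; apply/negP.
  move=> [Iw|[/= /negP w01 ->]]; last exact: J_out.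
  apply: (I_uniq m _ _ w) => //; apply: JI; exact: (Isub m c).
have pJ0 m c : (2 ^ m <= c)%N -> J m @^-1` [set c] = set0.
  move=> mc; rewrite -subset0 => w /= Jc.
  by have := J_lt m w; rewrite Jc ltnNge mc.
have mJ m c : measurable (J m @^-1` [set c] : set (measurableTypeR R)).
  have [mc|cm] := leqP (2 ^ m) c; first by rewrite pJ0.
  rewrite pJ//; apply: measurableU; first exact: measurable_itv.
  apply: measurableI; first by apply: measurableC; exact: measurable_itv.
  case: c {cm} => [|c].
    by rewrite (_ : [set w : R | _] = setT)//; apply/seteqP; split.
  by rewrite (_ : [set w : R | _] = set0)//; apply/seteqP; split.
exists J; split => //.
- by move=> m; exact: measurable_fun_to_nat.
- move=> m w; have [w01|w01] := boolP (w \in `[0, 1[); last by rewrite !J_out.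
  by apply: (I_uniq m _ _ w); [|apply: I_parent]; exact: JI.
- move=> m c; have [mc|cm] := leqP (2 ^ m) c.
    by rewrite pJ0// measure0 p_out.
  have FSle1 : F m c.+1 <= 1 by rewrite -(F1 m); exact: (F_homo m _ _ cm).
  have PI : uniform_prob (@ltr01 R) (I m c) = (p m c)%:E.
    by rewrite /I uniform01_itv// ?F_homo// FS addrAC subrr add0r.
  have P01 : uniform_prob (@ltr01 R) (~` `[0, 1[%classic) = 0%E.
    rewrite probability_setC; last exact: measurable_itv.
    by rewrite [X in (_ - X)%E]uniform01_itv// subr0 subee.
  (* The fiber of [J m] over [c] lies between [I m c] and its union with the null complement of [0,
     1[. *)
  apply/eqP; rewrite eq_le -PI; apply/andP; split.
    rewrite -[leRHS]adde0 -[X in (_ + X)%E]P01.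
    pose N : set (measurableTypeR R) := ~` `[0, 1[%classic.
    have mN : measurable N by apply: measurableC; exact: measurable_itv.
    have mI : measurable (I m c : set (measurableTypeR R)).
      exact: measurable_itv.
    apply: (@le_trans _ _ (uniform_prob (@ltr01 R) (I m c `|` N))).
      apply: le_measure; rewrite ?inE//; first exact: measurableU.
      by rewrite pJ//; apply: setUS => w [].
    exact: measureU2.
  apply: le_measure; rewrite ?inE//; first exact: measurable_itv.
  by rewrite pJ//; exact: subsetUl.
Qed.

(** * Integrals of bounded functions *)

Lemma integrable_le_bound d (T : measurableType d) (R : realType)
    (P : probability T R) (f : T -> R) (M : R) :
  measurable_fun setT f -> (forall x, `|f x| <= M) ->
  P.-integrable setT (EFin \o f).
Proof.
move=> mf fM; apply: measurable_bounded_integrable => //.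
  by rewrite -ge0_fin_numE// fin_num_measure.
by exists M; split; [exact: num_real|move=> N MN x _; exact: le_trans (ltW MN)].
Qed.

(** As [J] takes finitely many values, [h (J x)] is a finite combination of indicators of fibers.
    Linearity is proved by induction on the partial sums [g n]; at [g N] exactly one indicator is
    nonzero at each point. *)
Lemma Rintegral_comp_nat d (T : measurableType d) (R : realType)
    (P : probability T R) (J : T -> nat) (N : nat) (h : nat -> R) :
  measurable_fun setT J -> (forall x, (J x < N)%N) ->
  \int[P]_x h (J x) = \sum_(c < N) h c * fine (P (J @^-1` [set (c : nat)])).
Proof.
move=> mJ JN.
have mJc c : measurable (J @^-1` [set c]).
  by rewrite -[X in measurable X]setTI; exact: mJ.
pose g n x : R := \sum_(c < n) h c * \1_(J @^-1` [set (c : nat)]) x.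
have iind c : P.-integrable setT (EFin \o (\1_(J @^-1` [set c]) : T -> R)).
  apply: (@integrable_le_bound _ _ _ _ _ 1); first exact: measurable_indic.
  by move=> x; rewrite indicE; case: (_ \in _); rewrite ?normr1 ?normr0.
have ihind c : P.-integrable setT
    (EFin \o (fun x => h c * \1_(J @^-1` [set c]) x : R)).
  exact: (integrableZl measurableT (h c) (iind c)).
have gE n : P.-integrable setT (EFin \o g n) /\
    \int[P]_x g n x = \sum_(c < n) h c * fine (P (J @^-1` [set (c : nat)])).
  elim: n => [|n [ig IH]].
    rewrite (_ : g 0%N = cst 0); last by apply/funext => x; rewrite /g big_ord0.
    by rewrite big_ord0 Rintegral_cst// mul0r; split => //; exact: integrable0.
  rewrite (_ : g n.+1 = g n \+ (fun x => h n * \1_(J @^-1` [set n]) x));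
      last first.
    by apply/funext => x; rewrite /g big_ord_recr.
  split; first exact: (integrableD measurableT ig (ihind n)).
  rewrite RintegralD// IH big_ord_recr/=; congr (_ + _).
  rewrite RintegralZl//; congr (_ * _).
  by rewrite /Rintegral integral_indic// setIT.
rewrite -(gE N).2; apply: eq_Rintegral => x _; rewrite /g.
rewrite (bigD1 (Ordinal (JN x)))//= big1 ?addr0.
  by rewrite indicE mem_set// mulr1.
move=> i iJ; rewrite indicE memNset ?mulr0// => /= Ji.
by move/eqP: iJ; apply; apply/val_inj.
Qed.

(** * Itineraries and the limits of their laws *)

(* [itinerary B m x] is the number whose binary digits record, most significant
   first, which of [B 0, ..., B m.-1] contain [x]. *)
Fixpoint itinerary (T : Type) (B : nat -> set T) (m : nat) (x : T) : nat :=
  if m is k.+1 then ((x \in B k) + (itinerary B k x).*2)%N else 0%N.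

Lemma itinerary_half (T : Type) (B : nat -> set T) m x :
  itinerary B m x = (itinerary B m.+1 x)./2.
Proof. by rewrite /= half_bit_double. Qed.

Lemma itinerary_odd (T : Type) (B : nat -> set T) m x :
  odd (itinerary B m.+1 x) = (x \in B m).
Proof. by rewrite /= oddD odd_double addbF oddb. Qed.

Lemma itinerary_lt (T : Type) (B : nat -> set T) m x :
  (itinerary B m x < 2 ^ m)%N.
Proof.
elim: m => [|m IH]; first by rewrite expn0.
rewrite expnS mul2n /=; apply: (@leq_trans (itinerary B m x).+1.*2).
  by rewrite doubleS; case: (_ \in _).
by rewrite leq_double.
Qed.

Lemma itinerary_preimage_split (T : Type) (B : nat -> set T) m c :
  itinerary B m @^-1` [set c] =
  itinerary B m.+1 @^-1` [set c.*2] `|` itinerary B m.+1 @^-1` [set c.*2.+1].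
Proof.
apply/seteqP; split=> x; rewrite [X in X -> _]/=.
  by move=> <-; rewrite /=; case: (_ \in _); [right|left].
rewrite /preimage/= => -[] xc;
  rewrite (itinerary_half B) [itinerary _ _ _]xc /=.
  by rewrite doubleK.
by rewrite uphalf_double.
Qed.

Lemma measurable_itinerary d (T : measurableType d) (B : nat -> set T) m :
  (forall i, measurable (B i)) -> measurable_fun setT (itinerary B m).
Proof.
move=> mB; apply: measurable_fun_to_nat; elim: m => [|m IH] c.
  case: c => [|c].
    by rewrite (_ : _ @^-1` _ = setT)//; apply/seteqP; split.
  by rewrite (_ : _ @^-1` _ = set0)//; apply/seteqP; split.
rewrite (_ : _ @^-1` _ = itinerary B m @^-1` [set c./2] `&`
    (if odd c then B m else ~` B m)).
  by apply: measurableI => //; case: odd => //; exact: measurableC.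
apply/seteqP; split=> x.
  move=> /= <-; rewrite half_bit_double oddD odd_double addbF oddb.
  split=> //; case: ifPn => [/set_mem|/negP xB xBm] //.
  by apply: xB; exact/mem_set.
move=> /= [-> xB]; rewrite -[RHS]odd_double_half; congr addn.
by case: odd xB => xB; [rewrite mem_set|rewrite memNset].
Qed.

(** The masses of all fibers form a countable family in [0, 1], so they converge along one
    subsequence. The limits inherit the dyadic splitting and are realized by [dyadic_coupling];
    integrals of functions of an itinerary are finite sums of these masses. *)
Lemma itinerary_coupling d (T : measurableType d) (R : realType)
    (mu : nat -> probability T R) (B : nat -> set T) :
  (forall i, measurable (B i)) ->
  exists psi : nat -> nat, increasing_seq psi /\
  exists J : nat -> measurableTypeR R -> nat,
    [/\ forall m, measurable_fun setT (J m),
        forall m w, J m w = (J m.+1 w)./2 &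
        forall m (h : nat -> R),
          \int[mu (psi n)]_x h (itinerary B m x) @[n --> \oo] -->
          \int[uniform_prob (@ltr01 R)]_w h (J m w)].
Proof.
move=> mB.
have mC m c : measurable (itinerary B m @^-1` [set c]).
  by rewrite -[X in measurable X]setTI; exact: measurable_itinerary.
pose q n (mc : nat * nat) := fine (mu n (itinerary B mc.1 @^-1` [set mc.2])).
have q01 n mc : 0 <= q n mc <= 1.
  rewrite fine_ge0//= -lee_fin fineK ?fin_num_measure//.
  exact: probability_le1.
(* Pairs (m, c) are coded by naturals; a natural that codes no pair gets the constant sequence 0. *)
have [|psi [psi_incr [p0 p0P]]] := @pointwise_cvg_subseq R
    (fun n i => if unpickle i is Some mc then q n mc else 0).
  by move=> n i; case: unpickle => [mc|]; [exact: q01|rewrite lexx ler01].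
exists psi; split => //.
pose p (m c : nat) := p0 (pickle (m, c)).
have pP m c : q (psi n) (m, c) @[n --> \oo] --> p m c.
  have := p0P (pickle (m, c)); rewrite /p.
  by under eq_cvg do rewrite pickleK.
have p00 : p 0%N 0%N = 1.
  apply: (cvg_unique _ (pP 0%N 0%N)) => //; rewrite /q.
  rewrite (_ : (fun n => _) = cst 1); first exact: cvg_cst.
  apply/funext => n; rewrite (_ : _ @^-1` _ = setT) ?probability_setT//.
  by apply/seteqP; split.
have p_ge0 m c : 0 <= p m c.
  apply: (cvgr_to_ge (pP m c)); apply: nearW => n.
  by case/andP: (q01 (psi n) (m, c)).
have p_split m c : p m c = p m.+1 c.*2 + p m.+1 c.*2.+1.
  apply: (cvg_unique _ (pP m c)) => //.
  rewrite (_ : (fun n => _) =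
    (fun n => q (psi n) (m.+1, c.*2) + q (psi n) (m.+1, c.*2.+1))).
    exact: (cvgD (pP _ _) (pP _ _)).
  apply/funext => n; rewrite {1}/q itinerary_preimage_split measureU//.
    by rewrite fineD// fin_num_measure.
  rewrite -subset0 => x /= [-> /eqP].
  by rewrite -addn1 -[X in X == _]addn0 eqn_add2l.
have p_out m c : (2 ^ m <= c)%N -> p m c = 0.
  move=> mc; apply: (cvg_unique _ (pP m c)) => //; rewrite /q.
  rewrite (_ : (fun n => _) = cst 0); first exact: cvg_cst.
  apply/funext => n; rewrite (_ : _ @^-1` _ = set0) ?measure0//.
  rewrite -subset0 => x /= xc.
  by have := itinerary_lt B m x; rewrite xc ltnNge mc.
have [J [mJ J_half J_lt PJ]] := dyadic_coupling p00 p_ge0 p_split p_out.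
exists J; split => // m h.
rewrite (Rintegral_comp_nat _ _ (mJ m) (J_lt m)).
under eq_cvg do rewrite (Rintegral_comp_nat _ _ (measurable_itinerary m mB)
  (itinerary_lt B m)).
apply: cvg_big => [|c _]; first exact: add_continuous.
rewrite (_ : fine (_ (J m @^-1` _)) = fine (p m c)%:E).
  by apply: cvgM; [exact: cvg_cst|exact: pP].
by congr fine; exact: PJ.
Qed.

(** * Borel functions, image laws and dominated convergence *)

Lemma continuous_borel_measurable (R : realType) (X : completeMetricType R)
    (f : X -> R) :
  continuous f -> measurable_fun [set: borelType X] (f : borelType X -> R).
Proof.
move=> /continuousP cf.
apply: (measurability _ (RGenOInfty.measurableE R)).
move=> _ [_ [a ->] <-]; rewrite setTI.
by apply: sub_sigma_algebra; apply: cf; exact: interval_open.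
Qed.

Lemma Rintegral_distribution d d' (T : measurableType d)
    (T' : measurableType d') (R : realType) (P : probability T R)
    (X : {mfun T >-> T'}) (f : T' -> R) (M : R) :
  measurable_fun setT f -> (forall y, `|f y| <= M) ->
  \int[distribution P X]_y f y = \int[P]_x f (X x).
Proof.
move=> mf fM; rewrite /Rintegral (@integral_distribution _ _ _ _ _ P X)//.
  exact/measurable_EFinP.
apply: (@integrable_le_bound _ _ _ P (f \o X) M) => [|x]; last exact: fM.
exact: measurableT_comp.
Qed.

Lemma bounded_Rintegral_cvg d (T : measurableType d) (R : realType)
    (P : probability T R) (N : set T) (g : nat -> T -> R) (f : T -> R) (M : R) :
  (forall m, measurable_fun setT (g m)) -> measurable_fun setT f ->
  (forall m x, `|g m x| <= M) ->
  measurable N -> P N = 0%E ->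
  (forall x, ~ N x -> g m x @[m --> \oo] --> f x) ->
  \int[P]_x g m x @[m --> \oo] --> \int[P]_x f x.
Proof.
move=> mg mf gM mN PN gf.
have [|||||fi _ gfi] := @dominated_convergence _ _ _ P _ measurableT
    (fun m => EFin \o g m) (EFin \o f) (cst M%:E).
- by move=> m; exact/measurable_EFinP.
- exact/measurable_EFinP.
- exists N; split => // x /= gfx; apply: contrapT => /gf gx; apply: gfx => _.
  exact: cvg_comp gx _.
- apply: (@integrable_le_bound _ _ _ P (cst M) `|M|) => //.
- exists N; split => // x /=.
  by move=> gfx; exfalso; apply: gfx => m _; rewrite lee_fin.
apply: fine_cvg; rewrite fineK//.
exact: (integrable_fin_num measurableT).
Qed.

(** * Fibers of itineraries and their limit points *)

(** Halving forgets the last digit, so agreeing with the longer itinerary [j n] implies agreeing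
    with its prefix [j m]. *)
Lemma itinerary_fiber_nested (T : Type) (B : nat -> set T) (j : nat -> nat) :
  (forall m, j m = (j m.+1)./2) ->
  forall m n, (m <= n)%N ->
    itinerary B n @^-1` [set j n] `<=` itinerary B m @^-1` [set j m].
Proof.
move=> j_half m n /subnK <-; elim: (n - m)%N => [//|k IH] x /= xk.
by apply: IH; rewrite /= j_half (itinerary_half B) [itinerary _ _ _]xk.
Qed.

Lemma itinerary_fiber_sub (T : Type) (B : nat -> set T) (c i : nat) :
  odd c -> itinerary B i.+1 @^-1` [set c] `<=` B i.
Proof.
by move=> oc x xc; apply/set_mem; rewrite -itinerary_odd [itinerary _ _ _]xc.
Qed.

Section limit_map.
Context {R : realType} {X : completeMetricType R}.
Variables (z : nat -> X) (r : nat -> R).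
Let B i : set X := ball (z i) (r i).

(** Oddness of [j i.+1] puts its fiber inside [B i], so the second clause provides fibers contained
    in balls of arbitrarily small radius. *)
Definition shrinking (j : nat -> nat) :=
  (forall m, itinerary B m @^-1` [set j m] !=set0) /\
  (forall q, exists i, r i <= q.+1%:R^-1 /\ odd (j i.+1)).

(** Points chosen in the successive fibers form a Cauchy sequence, since the fibers are nested and
    eventually inside a small ball; completeness provides [x]. *)
Lemma shrinking_limit (j : nat -> nat) :
  (forall m, j m = (j m.+1)./2) -> shrinking j ->
  exists x : X, forall e, 0 < e ->
    exists m, itinerary B m @^-1` [set j m] `<=` ball x e.
Proof.
move=> j_half [D0 Dsmall].
have small e : 0 < e -> exists i,
    itinerary B i.+1 @^-1` [set j i.+1] `<=` ball (z i) e.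
  move=> e0; have [q _ qe] := near_infty_natSinv_lt (PosNum e0).
  have [i [ri oi]] := Dsmall q; exists i.
  move=> y yD; have := itinerary_fiber_sub oi yD; apply: le_ball.
  by apply: (le_trans ri); apply/ltW/qe => /=.
have [x_ x_D] := choice D0.
have cx : cauchy (x_ @ \oo).
  apply: cauchy_exP => e e0; have [i iD] := small e e0.
  exists (z i), i.+1 => // n /= ni; apply: iD.
  exact: (itinerary_fiber_nested j_half ni).
have /cvg_ex [x xx] : cvg (x_ @ \oo) by apply/cauchy_cvgP.
exists x => e e0; have e3 : 0 < e / 3 by rewrite divr_gt0.
have [i iD] := small _ e3; exists i.+1 => y yD.
have [N _ Nx] : \forall n \near \oo, ball x (e / 3) (x_ n).
  exact: (cvg_ball xx).
(* At this index [x_ n] is both close to the limit and in the small fiber, so it links [x] to [y]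
   through the center [z i]. *)
pose n := maxn N i.+1.
have xn : ball (z i) (e / 3) (x_ n).
  by apply/iD/(itinerary_fiber_nested j_half (leq_maxr N i.+1)).
rewrite (_ : e = e / 3 + e / 3 + e / 3); last by lra.
apply: (ball_triangle _ (iD _ yD)); apply: (ball_triangle _ (ball_sym xn)).
exact: (Nx n (leq_maxl _ _)).
Qed.

(** * The random limit point and its law *)

Section random_limit.
Context d {Omega : measurableType d} (P : probability Omega R).
Variable J : nat -> Omega -> nat.
Hypothesis mJ : forall m, measurable_fun setT (J m).
Hypothesis J_half : forall m w, J m w = (J m.+1 w)./2.

(** Every set of naturals is measurable, so any condition on a single [J m w] is an event; the
    measurability proofs below write their sets as countable combinations of such events. *)
Let mJS m (S : set nat) : measurable [set w | S (J m w)].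
Proof. by rewrite -[X in measurable X]setTI; exact: mJ. Qed.

Definition shrinking_set := [set w | shrinking (J^~ w)].

Let fiber m w : set X := itinerary B m @^-1` [set J m w].

Lemma measurable_shrinking_set : measurable shrinking_set.
Proof.
rewrite (_ : shrinking_set =
    \bigcap_m [set w | itinerary B m @^-1` [set J m w] !=set0] `&`
    \bigcap_q \bigcup_i [set w | r i <= q.+1%:R^-1 /\ odd (J i.+1 w)]).
  apply: measurableI; apply: bigcapT_measurable => m.
    exact: (mJS m (fun c => itinerary B m @^-1` [set c] !=set0)).
  apply: bigcupT_measurable => i.
  exact: (mJS i.+1 (fun c => r i <= m.+1%:R^-1 /\ odd c)).
apply/seteqP; split=> w [D0 Dsmall]; split.
- by move=> m _; exact: D0.
- by move=> q _; have [i ?] := Dsmall q; exists i.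
- by move=> m; exact: D0.
- by move=> q; have [i _ ?] := Dsmall q I; exists i.
Qed.

(** Imposing the value [point] off [shrinking_set] makes the map constant there, which keeps its
    preimages measurable. *)
Lemma limit_map_ex : exists L : Omega -> X, forall w,
  (shrinking_set w -> forall e, 0 < e -> exists m, fiber m w `<=` ball (L w) e)
  /\ (~ shrinking_set w -> L w = point).
Proof.
suff /choice[L LP] : forall w, exists x : X,
    (shrinking_set w -> forall e, 0 < e -> exists m, fiber m w `<=` ball x e)
    /\ (~ shrinking_set w -> x = point) by exists L.
move=> w.
have [sw|nsw] := pselect (shrinking_set w); last by exists point.
by have [x xP] := shrinking_limit (J_half^~ w) sw; exists x.
Qed.

Definition limit_map : Omega -> borelType X := sval (cid limit_map_ex).

Lemma limit_mapP w e : shrinking_set w -> 0 < e ->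
  exists m, fiber m w `<=` ball (limit_map w : X) e.
Proof. by rewrite /limit_map; case: cid => /= L /(_ w) [LP _] /LP; apply. Qed.

Lemma limit_map_point w : ~ shrinking_set w -> limit_map w = point.
Proof. by rewrite /limit_map; case: cid => /= L /(_ w) []. Qed.

Let fiber_nested w m n : (m <= n)%N -> fiber n w `<=` fiber m w.
Proof. exact: (itinerary_fiber_nested (J_half^~ w)). Qed.

(* [limit_map w] is only a limit of points of the fibers, so a fiber has to lie
   well inside [U] to force it into [U]. *)
Lemma limit_map_preimage (U : set X) : open U ->
  limit_map @^-1` U =
  shrinking_set `&` \bigcup_m \bigcup_q [set w |
    forall y, fiber m w y -> ball y q.+1%:R^-1 `<=` U] `|`
  ~` shrinking_set `&` [set w | U point].
Proof.
move=> oU; apply/seteqP; split=> w.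
  move=> /= Uw; have [sw|nsw] := pselect (shrinking_set w); last first.
    by right; split => //; rewrite -(limit_map_point nsw).
  left; split => //.
  have /nbhs_ballP [e /= e0 eU] : nbhs (limit_map w : X) U.
    exact: open_nbhs_nbhs.
  have e2 : 0 < e / 2 by rewrite divr_gt0.
  have [m mL] := limit_mapP sw e2.
  have [q _ qe] := near_infty_natSinv_lt (PosNum e2).
  exists m => //; exists q => // y /mL yL x xy; apply: eU.
  rewrite [e]splitr; apply: (ball_triangle yL).
  by apply: le_ball xy; apply/ltW/qe => /=.
move=> [[sw [m _ [q _ mqU]]]|[nsw Up]]; last by rewrite /= limit_map_point.
have q0 : 0 < q.+1%:R^-1 :> R by rewrite invr_gt0.
have [n nL] := limit_mapP sw q0.
(* A point of this deeper fiber lies in both the fiber well inside [U] and the fiber near the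
   limit. *)
have [y yD] := sw.1 (maxn m n).
apply: (mqU y); first exact: fiber_nested (leq_maxl m n) _ yD.
by apply/ball_sym/nL; exact: fiber_nested (leq_maxr m n) _ yD.
Qed.

Lemma measurable_limit_map : measurable_fun setT limit_map.
Proof.
apply: (@measurability _ _ _ (borelType X) setT limit_map (@open X) erefl).
move=> _ [U oU <-]; rewrite setTI.
rewrite limit_map_preimage//; apply: measurableU; apply: measurableI.
- exact: measurable_shrinking_set.
- apply: bigcupT_measurable => m; apply: bigcupT_measurable => q.
  exact: (mJS m (fun c => forall y, itinerary B m y = c ->
    ball y q.+1%:R^-1 `<=` U)).
- by apply: measurableC; exact: measurable_shrinking_set.
- have [Up|nUp] := pselect (U point).
    by rewrite (_ : [set w | _] = setT)//; apply/seteqP; split.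
  by rewrite (_ : [set w | _] = set0)//; apply/seteqP; split.
Qed.

Definition limit_law : probability (borelType X) R :=
  distribution P (mfun_Sub (mem_set measurable_limit_map)).

Variable mu : nat -> probability (borelType X) R.
Hypothesis mB : forall i, measurable (B i : set (borelType X)).
Hypothesis shrinking_ae : P (~` shrinking_set) = 0%E.
Hypothesis mu_cvg : forall m (h : nat -> R),
  \int[mu n]_x h (itinerary B m x) @[n --> \oo] --> \int[P]_w h (J m w).

Lemma limit_law_le_liminf (f : X -> R) (M : R) :
  continuous f -> (forall x, `|f x| <= M) -> forall e, 0 < e ->
  \forall n \near \oo, \int[limit_law]_x f x - e < \int[mu n]_x f x.
Proof.
move=> cf fM e e0.
have mf := continuous_borel_measurable cf.
have fle x : - M <= f x <= M by rewrite -ler_norml.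
pose h m (c : nat) := inf (f @` (itinerary B m @^-1` [set c])).
have hlb m c : has_lbound (f @` (itinerary B m @^-1` [set c])).
  by exists (- M) => _ [x _ <-]; case/andP: (fle x).
have h_itin m x : h m (itinerary B m x) <= f x.
  by apply: ge_inf => //; exists x.
(* The infimum over an empty fiber is 0 by convention, and [M] is nonnegative as it bounds [f] in
   absolute value at [point]. *)
have hM m c : `|h m c| <= M.
  have [[x xc]|/set0P/negP/negPn/eqP c0] :=
      pselect (itinerary B m @^-1` [set c] !=set0); last first.
    by rewrite /h c0 image_set0 inf0 normr0 (le_trans _ (fM point)).
  rewrite ler_norml; apply/andP; split.
    apply: lb_le_inf; first by exists (f x), x.
    by move=> _ [y _ <-]; case/andP: (fle y).
  by rewrite -xc; apply: (le_trans (h_itin m x)); case/andP: (fle x).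
(* By continuity [f] varies little on a fiber close to the limit point, so its infimum there is
   close to [f (limit_map w)]. *)
have h_cvg w : ~ (~` shrinking_set) w ->
    h m (J m w) @[m --> \oo] --> f (limit_map w).
  move=> /contrapT sw; apply/cvgrPdist_le => d0 d0_gt0.
  have /nbhs_ballP [e' /= e'0 fe'] :
      \forall y \near (limit_map w : X), `|f (limit_map w) - f y| <= d0.
    by have /cvgrPdist_le/(_ d0 d0_gt0) := cf (limit_map w : X).
  have [k kL] := limit_mapP sw e'0.
  exists k => // m /= km.
  have fD y : fiber m w y -> `|f (limit_map w) - f y| <= d0.
    by move=> yD; apply/fe'/kL; exact: fiber_nested km _ yD.
  have [y yD] := sw.1 m.
  have hy : h m (J m w) <= f y by apply: ge_inf => //; exists y.
  have hL : f (limit_map w) - d0 <= h m (J m w).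
    apply: lb_le_inf; first by exists (f y), y.
    by move=> _ [x xD <-]; move: (fD x xD); rewrite ler_distl => /andP[]; lra.
  by move: (fD y yD); rewrite !ler_distl => /andP[? ?]; apply/andP; split; lra.
have mh0 m : measurable_fun setT (h m) by [].
have mh m : measurable_fun setT (fun w => h m (J m w)).
  exact: (measurableT_comp (mh0 m) (mJ m)).
have : \int[P]_w h m (J m w) @[m --> \oo] --> \int[P]_w f (limit_map w).
  apply: (bounded_Rintegral_cvg _ _ _ _ shrinking_ae) => //.
  - exact: (measurableT_comp mf measurable_limit_map).
  - by apply: measurableC; exact: measurable_shrinking_set.
have -> : \int[P]_w f (limit_map w) = \int[limit_law]_x f x.
  by rewrite (Rintegral_distribution _ _ mf fM).
(* The level [k] is fixed first, with the mean of [h k (J k w)] already above the target; only then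
   does [n] tend to infinity. *)
move=> /cvgr_gt /(_ (\int[limit_law]_x f x - e)).
rewrite ltrBlDr ltrDl => /(_ e0) [k _ /(_ k (leqnn k)) /= kP].
have [N _ hN] := cvgr_gt _ (@mu_cvg k (h k)) _ kP.
exists N => // n /= Nn; apply: (lt_le_trans (hN n Nn)).
apply: le_Rintegral => //.
- apply: (@integrable_le_bound _ _ _ _ _ M) => [|x]; last exact: hM.
  exact: (measurableT_comp (mh0 k) (measurable_itinerary k mB)).
- exact: (@integrable_le_bound _ _ _ _ _ M).
Qed.

Lemma limit_law_weak_cvg : weak_cvg mu limit_law.
Proof.
move=> f cf [M0 [_ fM0]].
(* Boundedness gives a bound by every number strictly above [M0], hence the added 1. *)
have fM x : `|f x| <= M0 + 1 by apply: fM0 => //; rewrite ltrDl.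
have NfM x : `|- f x| <= M0 + 1 by rewrite normrN.
have cNf : continuous (fun x => - f x) by move=> x; apply: cvgN; exact: cf.
have RN (nu : probability (borelType X) R) :
    \int[nu]_x (- f x) = - \int[nu]_x f x.
  rewrite -mulN1r -RintegralZl//.
    by apply: eq_Rintegral => x _; rewrite mulN1r.
  apply: (@integrable_le_bound _ _ _ _ _ (M0 + 1)) => //.
  exact: continuous_borel_measurable.
apply/cvgrPdist_lt => e e0.
have := limit_law_le_liminf cf fM e0.
have := limit_law_le_liminf cNf NfM e0.
apply: filterS2 => n; rewrite !RN => lo hi.
by rewrite ltr_distl; apply/andP; split; lra.
Qed.

End random_limit.
End limit_map.

(** * Finite ball covers from tightness, and transfer of mass bounds to the limit *)

Lemma increasing_seq_ge (u : nat -> nat) n : increasing_seq u -> (n <= u n)%N.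
Proof.
move=> /increasing_seqP u_incr; elim: n => // n IH.
exact: leq_ltn_trans IH (u_incr n).
Qed.

(** The lower limit is the supremum of the tail infima, so some tail infimum already exceeds [a]. *)
Lemma lt_limn_einf (R : realType) (u : (\bar R)^nat) (a : \bar R) :
  (a < limn_einf u)%E -> \forall n \near \oo, (a < u n)%E.
Proof.
rewrite limn_einf_lim (cvg_lim _ (@cvg_einfs_sup R u))//.
move=> /ereal_sup_gt [_ [N _ <-] aN]; exists N => // n /= Nn.
by apply: (lt_le_trans aN); apply: ereal_inf_lbound; exists n.
Qed.

Lemma metric_ball_open (R : realType) (X : metricType R) (x : X) (e : R) :
  open (ball x e).
Proof.
rewrite openE => y; rewrite ballEmdist /= => xy.
apply/nbhs_ballP; exists (e - mdist x y) => /=; first by rewrite subr_gt0.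
move=> t; rewrite ballEmdist /= => yt.
by apply: (le_lt_trans (metric_triangle x y t)); lra.
Qed.

(** Finitely many balls of radius e/2 cover [K]; doubling their radii absorbs the e/2-neighborhood
    by the triangle inequality. *)
Lemma compact_set_ball_cover (R : realType) (X : completeMetricType R)
    (K : set X) (e : R) : compact K -> 0 < e ->
  exists s : seq X,
    set_ball K (e / 2) `<=` \bigcup_(k in `I_(size s)) ball (nth point s k) e.
Proof.
move=> cK e0; have e2 : 0 < e / 2 by rewrite divr_gt0.
have [||D _ KD] := (iffLR (predeqP _ _) (@compact_cover X) K).1 cK X K
    (fun x => ball x (e / 2)).
- by move=> x _; exact: metric_ball_open.
- by move=> x Kx; exists x => //; exact: ballxx.
exists (finmap.enum_fset D) => y [x Kx xy].
have [t tD tx] := KD x Kx.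
exists (index t (finmap.enum_fset D)); first by rewrite /= index_mem.
by rewrite nth_index// [e]splitr; exact: ball_triangle tx xy.
Qed.

(** This reads every shorter prefix, hence every digit, off a single long itinerary. *)
Lemma iter_half_shift (j : nat -> nat) : (forall m, j m = (j m.+1)./2) ->
  forall m n, (m <= n)%N -> j m = iter (n - m) half (j n).
Proof.
move=> j_half m n /subnK <-; rewrite addnK.
elim: (n - m)%N => // k IH; rewrite IH addSn iterSr.
by rewrite -j_half.
Qed.

(** Convergence is assumed for all functions on [nat], so the indicator of [S] is an admissible test
    function. *)
Lemma preimage_le_of_cvg d d' (T : measurableType d) (Omega : measurableType d')
    (R : realType) (mu : nat -> probability T R) (P : probability Omega R)
    (f : T -> nat) (g : Omega -> nat) (S : set nat) (e : R) :
  measurable_fun setT f -> measurable_fun setT g ->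
  (forall h : nat -> R,
    \int[mu n]_x h (f x) @[n --> \oo] --> \int[P]_w h (g w)) ->
  (\forall n \near \oo, (mu n (f @^-1` S) <= e%:E)%E) ->
  (P (g @^-1` S) <= e%:E)%E.
Proof.
move=> mf mg cvg_fg mu_le.
have indicE d0 (U : measurableType d0) (Q : probability U R) (k : U -> nat) :
    measurable_fun setT k -> \int[Q]_x \1_S (k x) = fine (Q (k @^-1` S)).
  move=> mk; rewrite /Rintegral.
  have mkS : measurable (k @^-1` S).
    by rewrite -[X in measurable X]setTI; exact: mk.
  by rewrite -[in RHS](setIT (k @^-1` S)) -integral_indic.
rewrite -[leLHS]fineK ?fin_num_measure ?lee_fin//; last first.
  by rewrite -[X in measurable X]setTI; exact: mg.
rewrite -indicE//; apply: (cvgr_to_le (cvg_fg \1_S)).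
move: mu_le => [N _ muN]; exists N => // n /= Nn.
rewrite indicE// -lee_fin fineK; first exact: muN.
by rewrite fin_num_measure// -[X in measurable X]setTI; exact: mf.
Qed.

Lemma measurable_ball_borel (R : realType) (X : completeMetricType R) (x : X)
    (e : R) : measurable (ball x e : set (borelType X)).
Proof. by apply: sub_sigma_algebra; exact: metric_ball_open. Qed.

(** Halving [eps] turns the weak bound on the lower limit into a strict one, which then holds for
    all large [n]; halving [delta] leaves room for the finite cover. *)
Lemma asymp_tight_finite_balls (R : realType) (X : completeMetricType R)
    (mu : nat -> probability (borelType X) R) (eps delta : R) (K : set X) :
  0 < eps -> 0 < delta -> compact K ->
  ((1 - eps / 2)%:E <= limn_einf (fun n => mu n (set_ball K (delta / 2))))%E ->
  exists s : seq X, \forall n \near \oo,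
    ((1 - eps)%:E <=
     mu n (\bigcup_(k in `I_(size s)) ball (nth point s k) delta))%E.
Proof.
move=> e0 d0 cK muK; have [s Ks] := compact_set_ball_cover cK d0.
exists s; have : ((1 - eps)%:E <
    limn_einf (fun n => mu n (set_ball K (delta / 2))))%E.
  by apply: lt_le_trans muK; rewrite lte_fin; lra.
move=> /lt_limn_einf [N _ muN]; exists N => // n /= Nn.
apply: (le_trans (ltW (muN n Nn))); apply: le_measure => //; rewrite inE.
  apply: sub_sigma_algebra; apply: bigcup_open => x _.
  exact: metric_ball_open.
by apply: bigcup_measurable => k _; exact: measurable_ball_borel.
Qed.

(** * Almost sure shrinking of the random itineraries *)

Theorem corollary1p3 (R : realType) (X : completeMetricType R)
    (mu : nat -> probability (borelType X) R)
    (asymp_tight : forall eps delta : R, 0 < eps -> 0 < delta ->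
      exists K : set X, compact K /\
        ((1 - eps)%:E <= limn_einf (fun n => mu n (set_ball K delta)))%E) :
  precompact_seq mu.
Proof.
move=> phi phi_incr.
have /choice[s s_cover] : forall ab : nat * nat, exists s : seq X,
    \forall n \near \oo, ((1 - ab.1.+1%:R^-1)%:E <=
      mu n (\bigcup_(k in `I_(size s)) ball (nth point s k) ab.2.+1%:R^-1))%E.
  move=> [a b]; have [||K [cK muK]] :=
    asymp_tight (a.+1%:R^-1 / 2) (b.+1%:R^-1 / 2).
  - by rewrite divr_gt0.
  - by rewrite divr_gt0.
  - exact: asymp_tight_finite_balls cK muK.
(* The balls are enumerated by codes of triples ((a, b), k): the k-th center of [s (a, b)] with
   radius 1/(b+1). An index coding no triple gets radius 0, hence an empty ball. *)
pose z i := if unpickle i is Some (ab, k) then nth point (s ab) k else point.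
pose r i : R := if (unpickle i : option (nat * nat * nat)) is Some (ab, _)
  then ab.2.+1%:R^-1 else 0.
pose B i : set X := ball (z i) (r i).
have mB i : measurable (B i : set (borelType X)).
  exact: measurable_ball_borel.
have [psi [psi_incr [J [mJ J_half J_cvg]]]] :=
  itinerary_coupling (fun n => mu (phi n)) mB.
exists psi; split => //; exists 
  (limit_law z r (uniform_prob (@ltr01 R)) mJ J_half).
apply: limit_law_weak_cvg => //.
have mphi N n : (N <= n)%N -> (N <= phi (psi n))%N.
  move=> Nn; apply: (leq_trans Nn).
  apply: (leq_trans (increasing_seq_ge n psi_incr)).
  exact: increasing_seq_ge.
have mJS m (S : set nat) : measurable (J m @^-1` S).
  by rewrite -[X in measurable X]setTI; exact: mJ.
have PJ_le m (S : set nat) (e : R) :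
    (\forall n \near \oo,
      (mu (phi (psi n)) (itinerary B m @^-1` S) <= e%:E)%E) ->
    (uniform_prob (@ltr01 R) (J m @^-1` S) <= e%:E)%E.
  exact: preimage_le_of_cvg (measurable_itinerary m mB) (mJ m) (J_cvg m).
(* Failure of shrinking means that some fiber is empty or that, for some [q], no ball of radius at
   most 1/(q+1) is entered. These countably many events are shown to be null. *)
pose empty m := J m @^-1` [set c | itinerary B m @^-1` [set c] = set0].
pose large q := \bigcap_i [set w | r i <= q.+1%:R^-1 -> ~~ odd (J i.+1 w)].
have m_large q : measurable (large q).
  apply: bigcapT_measurable => i.
  exact: (mJS i.+1 (fun c => r i <= q.+1%:R^-1 -> ~~ odd c)).
have P_empty m : uniform_prob (@ltr01 R) (empty m) = 0%E.
  apply/eqP; rewrite eq_le measure_ge0 andbT; apply: PJ_le.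
  (* No point has an itinerary with empty fiber, so the masses bounded here are all 0. *)
  apply: nearW => n; rewrite (_ : _ @^-1` _ = set0) ?measure0//.
  rewrite -subset0 => x /= x0.
  by have : (itinerary B m @^-1` [set itinerary B m x]) x by []; rewrite x0.
have P_large q : uniform_prob (@ltr01 R) (large q) = 0%E.
  apply/eqP; rewrite eq_le measure_ge0 andbT; apply/lee_addgt0Pr => e e0.
  rewrite add0e; have [a _ ae] := near_infty_natSinv_lt (PosNum e0).
  pose idx (k : nat) := pickle ((a, q), k).
  (* An itinerary of this length contains the digits of all the balls from [s (a, q)]; [S] collects
     those avoiding every one, so its mass is eventually at most 1/(a+1), which is below [e]. *)
  pose m := (\max_(k < size (s (a, q))) idx k).+1.
  have idx_m k : (k < size (s (a, q)))%N -> ((idx k).+1 <= m)%N.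
    by move=> ks; rewrite ltnS; exact: (leq_bigmax (Ordinal ks)).
  pose S := [set c | forall k, (k < size (s (a, q)))%N ->
    ~~ odd (iter (m - (idx k).+1) half c)].
  apply: (@le_trans _ _ (uniform_prob (@ltr01 R) (J m @^-1` S))).
    apply: le_measure; rewrite ?inE// => w wl k ks /=.
    rewrite -(iter_half_shift (J_half^~ w) (idx_m k ks)).
    by apply: (wl (idx k) I); rewrite /r pickleK.
  apply: PJ_le; have [N _ covN] := s_cover (a, q); exists N => // n /= Nn.
  have := covN _ (mphi _ _ Nn); set U := \bigcup_(k in _) _ => U_le.
  have mU : measurable (U : set (borelType X)).
    by apply: bigcup_measurable => k _; exact: measurable_ball_borel.
  apply: (@le_trans _ _ (mu (phi (psi n)) (~` U))).
    apply: le_measure; rewrite ?inE//.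
    - by rewrite -[X in measurable X]setTI; exact: (measurable_itinerary m mB).
    - exact: measurableC.
    move=> x xS [k /= ks xk]; move: (xS k ks).
    have x_half i : itinerary B i x = (itinerary B i.+1 x)./2.
      exact: itinerary_half.
    rewrite -(iter_half_shift x_half (idx_m k ks)) itinerary_odd.
    by move/negP; apply; apply/mem_set; rewrite /B /z /r pickleK.
  have [u Uu] : exists u, mu (phi (psi n)) U = u%:E.
    by exists (fine (mu (phi (psi n)) U)); rewrite fineK// fin_num_measure.
  move: U_le; rewrite probability_setC// Uu -EFinB !lee_fin /=.
  move=> U_le; apply: le_trans (ltW (ae a (leqnn a))).
  by rewrite lerBlDl -lerBlDr.
apply: measure_negligible.
  by apply: measurableC; exact: measurable_shrinking_set.
apply: (@negligibleS _ _ _ _ (\bigcup_m empty m `|` \bigcup_q large q)).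
  move=> w nsw; apply: contrapT => /not_orP[nE nL]; apply: nsw; split => [m|q].
    apply/set0P/negP => /eqP D0; apply: nE; exists m => //.
  apply: contrapT => nq; apply: nL; exists q => // i _ /= ri.
  by apply/negP => oi; apply: nq; exists i.
apply: negligibleU; apply: negligible_bigcup => m.
  by apply/negligibleP; [exact: mJS|exact: P_empty].
by apply/negligibleP; [exact: m_large|exact: P_large].
Qed.
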